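(* Let $t\leq m$ be positive integers and let $(\mathbb{F}_{2^m},+,\star)$ be a left pre-quasifield. Let $\gamma,\tau,h:\mathbb{F}_{2^m}\to\mathbb{F}_{2^t}$ and $\sigma:\mathbb{F}_{2^m}\to\mathbb{F}_{2^m}$ be maps such that $\gamma$ is balanced, $\tau$ is surjective and $\mathbb{F}_2$-linear, $\sigma$ is invertible, and $h$ is arbitrary. Define $f_1,f_2:\mathbb{F}_{2^m}\times\mathbb{F}_{2^m}\to\mathbb{F}_{2^t}$ by \[ f_1(x,y)=\gamma\Big(\star\tfrac{x}{y}\Big),\qquad f_2(x,y)=\tau\big(\sigma(y)\star x\big)+h(y). \] Then \[ d_H(f_1,\mathcal{A})=d_H(f_2,\mathcal{A})=\Big(1-\frac{1}{2^t}\Big)\big(2^{2m}-2^m\big). \]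
   Context: A left pre-quasifield is a triple $(Q,+,\star)$ where $(Q,+)$ is a finite abelian group and $\star:Q\times Q\to Q$ satisfies: (1) $x\star 0=0\star x=0$ for all $x$; (2) $x\star(y+z)=x\star y+x\star z$ for all $x,y,z$; (3) for every $a\neq 0$ the maps $x\mapsto x\star a$ and $x\mapsto a\star x$ are bijections of $Q$. Here $(Q,+)$ is the additive group of $\mathbb{F}_{2^m}$. The right division is defined by $\star\frac{x}{y}=a$ if $y\neq 0$ and $x=a\star y$, and $\star\frac{x}{y}=0$ if $y=0$. A map $g:A\to B$ between finite sets is balanced if $|g^{-1}(b)|=|A|/|B|$ for all $b\in B$. For functions $f,g:A\to B$, the Hamming distance $d_H(f,g)$ is the number of $a\in A$ with $f(a)\neq g(a)$. The domain $\mathbb{F}_{2^m}\times\mathbb{F}_{2^m}$ is viewed as the $\mathbb{F}_2$-vector space $\mathbb{F}_2^{2m}$ and $\mathbb{F}_{2^t}$ as $\mathbb{F}_2^t$; $\mathcal{A}$ denotes the set of affine maps (an $\mathbb{F}_2$-linear map plus a constant) from the domain to $\mathbb{F}_{2^t}$, and $d_H(f,\mathcal{A})=\min_{A\in\mathcal{A}}d_H(f,A)$. *)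

(* Defs.v *)
From HB Require Import structures.
From mathcomp Require Import all_boot all_order all_algebra all_field.
Set Implicit Arguments.
Unset Strict Implicit.
Unset Printing Implicit Defensive.
Import GRing.Theory.
Local Open Scope ring_scope.

(* Makes the product of two finLmodTypes a finLmodType, by joining the existing
   componentwise module structure with the finite one. *)
HB.saturate prod.

Section PreQuasifield.
Variables (Q : finZmodType) (star : Q -> Q -> Q).

Record left_prequasifield : Prop := LeftPrequasifield {
  star_zero : forall x, star x 0 = 0 /\ star 0 x = 0;
  star_distr : forall x y z, star x (y + z) = star x y + star x z;
  star_bij : forall a, a != 0 ->
    bijective (fun x => star x a) /\ bijective (fun x => star a x) }.

(* In a left pre-quasifield, the picked solution a exists and is unique when
   y != 0. *)
Definition rdiv (x y : Q) : Q :=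
  if y == 0 then 0 else odflt 0 [pick a | x == star a y].

End PreQuasifield.

Definition balanced (A B : finType) (g : A -> B) : Prop :=
  forall b, #|[set a | g a == b]|%:R = #|A|%:R / #|B|%:R :> rat.

Definition hamming_dist (A : finType) (B : eqType) (f g : A -> B) : nat :=
  #|[set a | f a != g a]|.

(* The default value #|A| bounds every Hamming distance, so this is the true
   minimum over S whenever S is nonempty. *)
Definition dist_to (A B : finType) (f : A -> B) (S : {set {ffun A -> B}}) : nat :=
  \big[minn/#|A|]_(g in S) hamming_dist f g.

Section Affine.
Variables U V : finLmodType 'F_2.

Definition is_linear (L : {ffun U -> V}) : bool :=
  [forall a : 'F_2, forall x, forall y, L (a *: x + y) == a *: L x + L y].

Definition affine_maps : {set {ffun U -> V}} :=
  [set g : {ffun U -> V} | [exists L : {ffun U -> V}, exists b : V,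
     is_linear L && [forall x, g x == L x + b]]].

Lemma affine_mapsP (g : {ffun U -> V}) :
  reflect (exists (L : {linear U -> V}) (b : V), forall x, g x = L x + b)
          (g \in affine_maps).
Proof.
rewrite inE; apply: (iffP existsP) => [[L /existsP[b /andP[linL /forallP gE]]]|].
  have linP : linear L.
    by move=> a x y; have /forallP/(_ x)/forallP/(_ y)/eqP := forallP linL a.
  pose mixin := GRing.isLinear.Build 'F_2 U V *:%R L linP.
  pose L' : {linear U -> V} := HB.pack (fun_of_fin L) mixin.
  by exists L', b => x; apply/eqP/gE.
case=> L [b gE]; exists [ffun x => L x]; apply/existsP; exists b.
apply/andP; split; last by apply/forallP => x; rewrite ffunE gE.
by apply/forallP => a; apply/forallP => x; apply/forallP => y;
   rewrite !ffunE linearP.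
Qed.

Definition dist_affine (f : U -> V) : nat := dist_to f affine_maps.

End Affine.

(* Main.v *)
(** The distance is q^2 minus the maximal agreement with an affine map L + c,
    and that agreement is bounded by kernel sizes.  Write q = 2^m, k = 2^t and e = q / k.
    For f2, fix y: the points where f2 (., y) and L + c agree lie in a fibre of
    the additive map x |-> tau (sigma y * x) - L (x, 0), so there are at most as
    many of them as kernel elements.  Summing over y and counting the pairs by x
    instead gives q + (q - 1) e.
    For f1, the subgroups U_a = {(a * y, y)} and U_oo = {(x, 0)} form a spread,
    and f1 is constantly gamma a on U_a minus 0.  The agreement on U_a is at
    most |ker L|U_a|, and is empty unless gamma a - c lies in im L, which holds
    for |im L| e values of a.  As each |ker L|U_a| is at least q / |im L| and
    these sizes add up to q + |ker L| = q + q^2 / |im L|, dropping the a's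
    outside this set leaves at most q + q e.
    Constant maps attain both bounds. *)

Require Import Defs.
From HB Require Import structures.
From mathcomp Require Import all_boot all_order all_algebra all_field.
From mathcomp Require Import zify ring.
Set Implicit Arguments.
Unset Strict Implicit.
Unset Printing Implicit Defensive.
Import GRing.Theory.
Local Open Scope ring_scope.

(** * Cardinals as sums of indicators *)

Lemma card_set_sum (T : finType) (P : pred T) :
  #|[set x | P x]| = (\sum_x P x)%N.
Proof. by rewrite -sum1dep_card big_mkcond; apply: eq_bigr => x _; case: (P x). Qed.

Lemma card_set_pair (S T : finType) (P : pred (S * T)) :
  #|[set p | P p]| = (\sum_y #|[set x | P (x, y)]|)%N.
Proof.
transitivity (\sum_x \sum_y P (x, y))%N.
  by rewrite card_set_sum pair_bigA; apply: eq_bigr => -[].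
by rewrite exchange_big; apply: eq_bigr => y _; rewrite card_set_sum.
Qed.

Lemma sum_neq_const (T : finType) (x0 : T) (e : nat) :
  (\sum_(x | x != x0) e + e = #|T| * e)%N.
Proof. by rewrite -sum_nat_const [RHS](bigD1 x0) //= addnC. Qed.

Lemma card_preim_bij (S T : finType) (f : S -> T) (P : pred T) :
  bijective f -> #|[set x | P (f x)]| = #|[set y | P y]|.
Proof.
by move=> bij_f; rewrite !card_set_sum [RHS](reindex f) //; apply: onW_bij.
Qed.

(** * Fibres of additive maps between finite groups *)

Section Fibres.
Variables (U V : finZmodType) (phi : U -> V).
Hypothesis phiD : {morph phi : x y / x + y}.

Let phi0 : phi 0 = 0.
Proof. by apply: (addrI (phi 0)); rewrite -phiD !addr0. Qed.

Lemma card_fibre x0 : #|[set x | phi x == phi x0]| = #|[set x | phi x == 0]|.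
Proof.
rewrite -[RHS](card_imset _ (addrI x0)); congr #|pred_of_set _|.
apply/setP => x; rewrite inE; apply/eqP/imsetP => [phix | [u]].
  exists (x - x0); last by rewrite addrC subrK.
  by rewrite inE; apply/eqP/(addIr (phi x0)); rewrite -phiD subrK add0r.
by rewrite inE => /eqP phiu ->; rewrite phiD phiu addr0.
Qed.

(** A fibre is either empty or a coset of the kernel. *)
Lemma card_fibre_le z : (#|[set x | phi x == z]| <= #|[set x | phi x == 0%R]|)%N.
Proof.
have [->|[x0]] := set_0Vmem [set x | phi x == z]; first by rewrite cards0.
by rewrite inE => /eqP <-; rewrite card_fibre.
Qed.

Lemma card_im_ker : #|U| = (#|[set phi x | x : U]| * #|[set x | phi x == 0%R]|)%N.
Proof.
rewrite -[LHS]sum1_card (partition_big phi (mem (phi @: U))) /=; last first.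
  by move=> x _; apply: imset_f.
rewrite -sum_nat_const; apply: eq_bigr => z /imsetP[x0 _ ->].
by rewrite sum1dep_card card_fibre.
Qed.

Lemma card_fibre_surj z : (forall z, exists x, phi x = z) ->
  #|U| = (#|V| * #|[set x | phi x == z]|)%N.
Proof.
move=> surj; have [x0 <-] := surj z; rewrite card_fibre card_im_ker.
congr (_ * _)%N; rewrite -[RHS]cardsT; congr #|pred_of_set _|; apply/setP => y.
by have [x <-] := surj y; rewrite inE imset_f.
Qed.

End Fibres.

(** * Distance to a set of maps through maximal agreement *)

Lemma dist_to_agreement (A B : finType) (f : A -> B) (S : {set {ffun A -> B}})
    (g0 : {ffun A -> B}) :
  g0 \in S ->
  (forall g, g \in S -> #|[set x | f x == g x]| <= #|[set x | f x == g0 x]|)%N ->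
  (dist_to f S + #|[set x | f x == g0 x]| = #|A|)%N.
Proof.
move=> Sg0 max_g0.
have distE (g : {ffun A -> B}) :
    (hamming_dist f g + #|[set x | f x == g x]| = #|A|)%N.
  rewrite -(cardC [set x | f x == g x]) addnC; congr (_ + _)%N.
  by apply: eq_card => x; rewrite !inE.
suff -> : dist_to f S = hamming_dist f g0 by apply: distE.
(* Distance and agreement add up to [#|A|], so [g0] minimises the distance; the lower bound must
   also hold for the default value [#|A|] of the minimum. *)
apply/eqP; rewrite eqn_leq; apply/andP; split; last first.
  rewrite /dist_to; elim/big_ind: _ => [|x y|g /max_g0].
  - exact: max_card.
  - by rewrite leq_min => -> ->.
  by have := distE g; have := distE g0; lia.
rewrite /dist_to; have: g0 \in index_enum {ffun A -> B} by apply: mem_index_enum.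
elim: (index_enum _) => //= g r IHr; rewrite big_cons inE => /orP[/eqP <-|/IHr le_r].
  by rewrite Sg0 geq_minl.
by case: ifP => // _; rewrite geq_min le_r orbT.
Qed.

(** * Agreement counts over a left pre-quasifield *)

Section Agreement.
Variables (Q V : finZmodType) (star : Q -> Q -> Q).
Hypothesis pq : left_prequasifield star.

Let starx0 x : star x 0 = 0. Proof. by case: (star_zero pq x). Qed.
Let star0x x : star 0 x = 0. Proof. by case: (star_zero pq x). Qed.
Let star_bijl y : y != 0 -> bijective (star^~ y).
Proof. by case/(star_bij pq). Qed.
Let star_bijr x : x != 0 -> bijective (star x).
Proof. by case/(star_bij pq). Qed.

Lemma rdiv_star a y : y != 0 -> rdiv star (star a y) y = a.
Proof.
move=> y0; rewrite /rdiv (negPf y0); case: pickP => [b /eqP eq_ab|/(_ a)].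
  exact/esym/(bij_inj (star_bijl y0)).
by rewrite eqxx.
Qed.

(* Sums over Q * Q along the spread; on both sides the origin is counted once
   for each a in Q and once more for {(x, 0)}. *)
Lemma sum_spread (G : Q -> Q * Q -> nat) :
  (\sum_p G (rdiv star p.1 p.2) p + \sum_a G a (0%R, 0%R)
    = \sum_a \sum_y G a (star a y, y) + \sum_x G 0%R (x, 0%R))%N.
Proof.
transitivity (\sum_x \sum_y G (rdiv star x y) (x, y) + \sum_a G a (0%R, 0%R))%N.
  by rewrite pair_bigA; congr (_ + _)%N; apply: eq_bigr => -[].
(* The row y = 0 gives the two single sums, as the quotient by 0 is 0 and a * 0 = 0. In any other
   row, x = a * y is a bijective change of variable. *)
rewrite exchange_big [in RHS]exchange_big /= (bigD1 0) //= [in RHS](bigD1 0) //=.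
under [X in (X + _ + _)%N]eq_bigr => x _ do rewrite /rdiv eqxx.
under [X in (_ = X + _ + _)%N]eq_bigr => a _ do rewrite starx0.
rewrite addnAC [RHS]addnC [RHS]addnA; congr (_ + _)%N.
apply: eq_bigr => y y0; rewrite (reindex (star^~ y)) /=; last exact/onW_bij/star_bijl.
by apply: eq_bigr => a _; rewrite rdiv_star.
Qed.

Section Quotient.
Variables (gamma : Q -> V) (e : nat).
Hypothesis gamma_fibre : forall b, #|[set a | gamma a == b]| = e.

(** The value [gamma 0] is the one taken on the whole row y = 0, which contributes [#|Q|]. Each of
    the [e] slopes with this value contributes a full line through the origin, and the [e] on the
    left corrects the repeated count of the origin. *)
Lemma quotient_agreement_const :
  (#|[set p | gamma (rdiv star p.1 p.2) == gamma 0%R]| + e = #|Q| + e * #|Q|)%N.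
Proof.
rewrite card_set_sum -{1}(gamma_fibre (gamma 0)) card_set_sum.
rewrite (sum_spread (fun a _ => gamma a == gamma 0)).
under eq_bigr => a _ do rewrite sum_nat_const.
rewrite -big_distrr /= -card_set_sum gamma_fibre.
by rewrite sum_nat_const eqxx muln1 addnC mulnC.
Qed.

Lemma quotient_agreement_le (L : Q * Q -> V) (c : V) :
  {morph L : x y / x + y} ->
  (#|[set p | gamma (rdiv star p.1 p.2) == (L p + c)%R]| + e <= #|Q| + e * #|Q|)%N.
Proof.
move=> LD.
have L00 : L (0, 0) = 0 by apply: (addrI (L 0)); rewrite -LD !addr0.
pose La a y := L (star a y, y); pose Loo x := L (x, 0).
have LaD a : {morph La a : x y / x + y}.
  by move=> x y; rewrite /La (star_distr pq) -LD.
have LooD : {morph Loo : x y / x + y}.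
  by move=> x y; rewrite /Loo -LD; congr (L (_, _)); rewrite addr0.
pose I := [set L p | p : Q * Q]; pose Ka a := #|[set y | La a y == 0]|.
pose Koo := #|[set x | Loo x == 0]|.
(* Only slopes in [S] can have agreement on their line. *)
pose S := [set a | gamma a - c \in I].
have agreeE : (#|[set p | gamma (rdiv star p.1 p.2) == (L p + c)%R]| + e
   = \sum_a #|[set y | La a y == (gamma a - c)%R]|
     + #|[set x | Loo x == (gamma 0 - c)%R]|)%N.
  (* The added [e] is the number of slopes a with [gamma a = c], that is, those for which the origin
     counts as an agreement. *)
  rewrite card_set_sum -{1}(gamma_fibre c) card_set_sum.
  have -> : (\sum_a (gamma a == c) = \sum_a (gamma a == (L (0%R, 0%R) + c)%R))%N.
    by rewrite L00 add0r.
  rewrite (sum_spread (fun a p => gamma a == L p + c)) card_set_sum.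
  congr (_ + _)%N; last by apply: eq_bigr => x _; rewrite -subr_eq eq_sym.
  apply: eq_bigr => a _; rewrite card_set_sum; apply: eq_bigr => y _.
  by rewrite -subr_eq eq_sym.
have kerE : (#|[set p | L p == 0%R]| + #|Q| = \sum_a Ka a + Koo)%N.
  rewrite -(sum1_card Q) /Koo !card_set_sum.
  have -> : (\sum_(a : Q) 1 = \sum_(a : Q) (L (0%R, 0%R) == 0%R))%N.
    by rewrite L00 eqxx.
  rewrite (sum_spread (fun a p => L p == 0)); congr (_ + _)%N.
  by apply: eq_bigr => a _; rewrite /Ka card_set_sum.
(* [S] is the disjoint union of the fibres of [gamma] over z + c, for z in [I]. *)
have cardS : #|S| = (#|I| * e)%N.
  rewrite -[LHS]sum1_card (partition_big (fun a => gamma a - c) (mem I)) /=; last first.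
    by move=> a; rewrite inE.
  rewrite -sum_nat_const; apply: eq_bigr => z Iz.
  rewrite -(gamma_fibre (z + c)) -sum1dep_card; apply: eq_bigl => a.
  by rewrite inE subr_eq andb_idl // => /eqP ->; rewrite addrK.
have Ka_ge a : (#|Q| <= #|I| * Ka a)%N.
  rewrite (card_im_ker (LaD a)) leq_mul2r; apply/orP; right.
  by apply/subset_leq_card/subsetP => _ /imsetP[y _ ->]; apply: imset_f.
have I_gt0 : (0 < #|I|)%N by apply/card_gt0P; exists (L 0); apply: imset_f.
have cardQ2 : (#|Q| * #|Q| = #|I| * #|[set p | L p == 0%R]|)%N.
  by rewrite -card_prod (card_im_ker LD).
have agree_S : (\sum_a #|[set y | La a y == (gamma a - c)%R]| <= \sum_(a in S) Ka a)%N.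
  rewrite [leqRHS]big_mkcond; apply: leq_sum => a _; case: ifPn => [_|].
    exact: card_fibre_le.
  apply: contraR; rewrite -ltnNge => /card_gt0P[y]; rewrite !inE => /eqP <-.
  exact: imset_f.
have agree_oo := card_fibre_le LooD (gamma 0 - c).
have SC : (#|Q| * (#|Q| - #|S|) <= #|I| * \sum_(a in ~: S) Ka a)%N.
  have -> : (#|Q| - #|S|)%N = #|~: S| by rewrite [RHS]cardsCs setCK.
  by rewrite mulnC -sum_nat_const big_distrr; apply: leq_sum => a _; apply: Ka_ge.
have splitS : (\sum_a Ka a = \sum_(a in S) Ka a + \sum_(a in ~: S) Ka a)%N.
  by rewrite (bigID (mem S)) /=; congr (_ + _)%N; apply: eq_bigl => a; rewrite in_setC.
have S_le : (#|S| <= #|Q|)%N by apply: max_card.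
rewrite agreeE -(leq_pmul2l I_gt0).
rewrite -/Koo in agree_oo.
move: kerE SC cardQ2 agree_S agree_oo cardS S_le; rewrite splitS.
move: (\sum_(a in S) _)%N (\sum_(a in ~: S) _)%N (\sum_a _)%N => A B C.
move: Koo #|S| #|I| #|Q| #|_| #|_| => k s r q n d.
(* r(C + d) <= r(A + k) = r(n + q - B) <= q^2 + rq - q(q - s) = r(q + eq), using rn = q^2 and s =
   re. *)
nia.
Qed.

End Quotient.

(** * The product function *)

Section Product.
Variables (tau : Q -> V) (h : Q -> V) (sigma : Q -> Q) (e : nat).
Hypothesis tauD : {morph tau : x y / x + y}.
Hypothesis tau_fibre : forall b, #|[set a | tau a == b]| = e.
Hypothesis sigma_bij : bijective sigma.

(** The row [y0] is constantly [h y0]; every other row is [tau] after a bijection, shifted by a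
    constant, and so takes this value [e] times. *)
Lemma product_agreement_const y0 : sigma y0 = 0 ->
  (#|[set p : Q * Q | (tau (star (sigma p.2) p.1) + h p.2)%R == h y0]| + e
    = #|Q| + e * #|Q|)%N.
Proof.
move=> sy0; rewrite card_set_pair (bigD1 y0) //=.
have tau0 : tau 0 = 0 by apply: (addrI (tau 0)); rewrite -tauD !addr0.
have -> : #|[set x | tau (star (sigma y0) x) + h y0 == h y0]| = #|Q|.
  by rewrite -cardsT; apply: eq_card => x; rewrite !inE sy0 star0x tau0 add0r eqxx.
rewrite -addnA; congr (_ + _)%N.
have fibE y : y != y0 -> #|[set x | tau (star (sigma y) x) + h y == h y0]| = e.
  move=> yy0; have sy : sigma y != 0 by rewrite -sy0 (inj_eq (bij_inj sigma_bij)).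
  rewrite (card_preim_bij (fun x => tau x + h y == h y0) (star_bijr sy)).
  rewrite -(tau_fibre (h y0 - h y)); apply: eq_card => x.
  by rewrite !inE [RHS]eq_sym subr_eq eq_sym.
by rewrite (eq_bigr (fun=> e)) // sum_neq_const mulnC.
Qed.

Lemma product_agreement_le (L : Q * Q -> V) (c : V) :
  {morph L : x y / x + y} ->
  (#|[set p : Q * Q | (tau (star (sigma p.2) p.1) + h p.2)%R == (L p + c)%R]| + e
    <= #|Q| + e * #|Q|)%N.
Proof.
move=> LD.
have L00 : L (0, 0) = 0 by apply: (addrI (L 0)); rewrite -LD !addr0.
have tau0 : tau 0 = 0 by apply: (addrI (tau 0)); rewrite -tauD !addr0.
pose phi y x := tau (star (sigma y) x) - L (x, 0).
have phiD y : {morph phi y : x x' / x + x'}.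
  move=> x x'; rewrite /phi (star_distr pq) tauD.
  have -> : (x + x', 0) = (x, 0) + (x', 0) :> Q * Q by congr (_, _); rewrite addr0.
  by rewrite LD opprD addrACA.
apply: (@leq_trans (\sum_y #|[set x | phi y x == 0%R]| + e)%N).
  rewrite leq_add2r card_set_pair; apply: leq_sum => y _ /=.
  apply: leq_trans (card_fibre_le (phiD y) (L (0, y) + c - h y)).
  apply/subset_leq_card/subsetP => x; rewrite !inE /phi => /eqP eq_xy.
  have -> : tau (star (sigma y) x) = L (x, y) + c - h y by rewrite -eq_xy addrK.
  have -> : (x, y) = (x, 0) + (0, y) :> Q * Q.
    by congr (_, _); rewrite ?addr0 ?add0r.
  by rewrite LD subr_eq -!addrA addrC -!addrA.
(* Counted by x, the kernel sizes have an exact sum: x = 0 lies in every kernel, and for x != 0 the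
   map y |-> [star (sigma y) x] is a bijection while [L (x, 0)] does not depend on y. *)
apply/eq_leq.
under eq_bigr => y _ do rewrite card_set_sum.
rewrite exchange_big /= (bigD1 0) //=.
have -> : (\sum_y (phi y 0%R == 0%R) = #|Q|)%N.
  rewrite -[RHS]sum1_card; apply: eq_bigr => y _.
  by rewrite /phi starx0 tau0 L00 subr0 eqxx.
rewrite -addnA; congr (_ + _)%N.
have fibE x : x != 0 -> (\sum_y (phi y x == 0%R))%N = e.
  move=> x0; rewrite -card_set_sum -(tau_fibre (L (x, 0))).
  rewrite -(card_preim_bij (fun w => tau w == L (x, 0)) (star_bijl x0)).
  rewrite -(card_preim_bij (fun s => tau (star s x) == L (x, 0)) sigma_bij).
  by apply: eq_card => y; rewrite !inE subr_eq0.
by rewrite (eq_bigr (fun=> e)) // sum_neq_const mulnC.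
Qed.

End Product.
End Agreement.

(** * Affine maps, cardinalities and the final computation *)

Lemma const_affine (U V : finLmodType 'F_2) (c : V) :
  [ffun=> c] \in affine_maps U V.
Proof.
apply/affine_mapsP; exists (\0 : {linear U -> V}), c => x.
by rewrite ffunE /= add0r.
Qed.

Lemma dist_affine_agreement (U V : finLmodType 'F_2) (f : U -> V) (c : V) (M : nat) :
  #|[set x | f x == c]| = M ->
  (forall (L : {linear U -> V}) b, #|[set x | f x == (L x + b)%R]| <= M)%N ->
  (dist_affine f + M = #|U|)%N.
Proof.
move=> cM leM.
have agree_c : #|[set x | f x == [ffun=> c] x]| = M.
  by rewrite -cM; apply: eq_card => x; rewrite !inE ffunE.
rewrite -{1}agree_c; apply: dist_to_agreement; first exact: const_affine.
move=> g /affine_mapsP[L [b gE]]; rewrite agree_c; apply: leq_trans (leM L b).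
by apply/subset_leq_card/subsetP => x; rewrite !inE gE.
Qed.

Lemma card_finvect (F : fieldExtType 'F_2) :
  #|finvect_type F| = (2 ^ \dim {:F})%N.
Proof.
have := card_vspace (fullv : {vspace finvect_type F}).
by rewrite card_Fp // => <-; apply/esym/card_vspacef.
Qed.

Theorem theorem1 (t m : nat) (t_gt0 : (0 < t)%N) (t_le_m : (t <= m)%N)
  (F K : fieldExtType 'F_2) (dimF : \dim {:F} = m) (dimK : \dim {:K} = t)
  (star : finvect_type F -> finvect_type F -> finvect_type F)
  (star_pq : left_prequasifield star)
  (gamma h : finvect_type F -> finvect_type K)
  (tau : {linear finvect_type F -> finvect_type K})
  (sigma : finvect_type F -> finvect_type F)
  (gamma_bal : balanced gamma)
  (tau_surj : forall z, exists x, tau x = z)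
  (sigma_bij : bijective sigma) :
  let f1 (p : finvect_type F * finvect_type F) : finvect_type K :=
    gamma (rdiv star p.1 p.2) in
  let f2 (p : finvect_type F * finvect_type F) : finvect_type K :=
    tau (star (sigma p.2) p.1) + h p.2 in
  (dist_affine f1)%:R
    = (1 - 1 / 2 ^+ t) * (2 ^+ (2 * m) - 2 ^+ m) :> rat
  /\ (dist_affine f2)%:R
    = (1 - 1 / 2 ^+ t) * (2 ^+ (2 * m) - 2 ^+ m) :> rat.
Proof.
move=> f1 f2.
have cardF : #|finvect_type F| = (2 ^ m)%N.
  by rewrite card_finvect dimF.
have cardK : #|finvect_type K| = (2 ^ t)%N.
  by rewrite card_finvect dimK.
pose e := (2 ^ (m - t))%N.
have eK : (2 ^ m = 2 ^ t * e)%N by rewrite -expnD subnKC.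
(* With q = ke, the maximal agreement q + eq - e leaves q^2 - q - eq + e = (1 - 1/k)(q^2 - q). *)
have distE d M : (M + e = 2 ^ m + e * 2 ^ m)%N -> (d + M = 2 ^ m * 2 ^ m)%N ->
    d%:R = (1 - 1 / 2 ^+ t) * (2 ^+ (2 * m) - 2 ^+ m) :> rat.
  move=> ME dE.
  have k0 : (2 : rat) ^+ t != 0 by rewrite expf_neq0.
  have qE : (2 : rat) ^+ m = 2 ^+ t * e%:R by rewrite -natrX eK natrM natrX.
  have : (d%:R + 2 ^+ m + e%:R * 2 ^+ m = 2 ^+ m * 2 ^+ m + e%:R :> rat).
    by rewrite -!natrX -!natrM -!natrD; congr _%:R; lia.
  rewrite mulnC exprM qE => dR.
  have {}dR : d%:R = 2 ^+ t * e%:R * (2 ^+ t * e%:R) + e%:R - 2 ^+ t * e%:R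
      - e%:R * (2 ^+ t * e%:R) :> rat.
    by rewrite -dR; ring.
  by rewrite dR; field.
have gamma_fibre b : #|[set a | gamma a == b]| = e.
  apply/eqP; rewrite -(Num.Theory.eqr_nat rat) gamma_bal.
  rewrite cardF cardK eK natrM mulrC mulKf //.
  by rewrite Num.Theory.pnatr_eq0 -lt0n expn_gt0.
have tau_fibre b : #|[set a | tau a == b]| = e.
  have := card_fibre_surj (raddfD tau) b tau_surj; rewrite cardF cardK eK => /eqP.
  by rewrite eqn_pmul2l ?expn_gt0 // => /eqP.
have cardF2 : #|{: finvect_type F * finvect_type F}| = (2 ^ m * 2 ^ m)%N.
  by rewrite card_prod cardF.
have [y0 sy0] : exists y0, sigma y0 = 0.
  by have [s _ sK] := sigma_bij; exists (s 0).
have max1 := quotient_agreement_const star_pq gamma_fibre.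
have max2 := product_agreement_const star_pq h (raddfD tau) tau_fibre sigma_bij sy0.
rewrite cardF in max1 max2.
split.
- apply: (distE _ _ max1); rewrite -cardF2.
  apply: (dist_affine_agreement (c := gamma 0)) => // L b.
  rewrite -(leq_add2r e) max1 -cardF.
  exact: (quotient_agreement_le star_pq gamma_fibre b (raddfD L)).
- apply: (distE _ _ max2); rewrite -cardF2.
  apply: (dist_affine_agreement (c := h y0)) => // L b.
  rewrite -(leq_add2r e) max2 -cardF.
  exact: (product_agreement_le star_pq h (raddfD tau) tau_fibre sigma_bij b (raddfD L)).
Qed.
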